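(* Let $A$ be a unique factorization domain and let $x,u\in A$ with $u$ invertible. Let $\alpha,\beta\in\mathbb{N}$, not both zero, and set $\delta=\gcd(\alpha,\beta)$. Then there exist $\rho\in\mathbb{Z}$ and a sign $\varepsilon\in\{1,-1\}$ such that $$\gcd(x^{\alpha}+1,\,u x^{\beta}+1)=\gcd\left(x^{\delta}+\varepsilon u^{\rho},\; u^{\alpha/\delta}-(-1)^{(\alpha-\beta)/\delta}\right),$$ where the equality of greatest common divisors in $A$ is understood up to invertible elements of $A$.
   Context: $\mathbb{N}=\{0,1,2,\dots\}$. Greatest common divisors in a unique factorization domain $A$ are defined only up to multiplication by invertible elements of $A$. *)

(* Defs.v *)
From HB Require Import structures.
From mathcomp Require Import all_boot all_order all_algebra.

Set Implicit Arguments.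
Unset Strict Implicit.
Unset Printing Implicit Defensive.

Import GRing.Theory.
Local Open Scope ring_scope.

Definition rdivides (A : idomainType) (a b : A) : Prop :=
  exists c : A, b = c * a.

Definition associates (A : idomainType) (a b : A) : Prop :=
  exists2 v : A, v \is a GRing.unit & b = v * a.

Definition irreducible_elt (A : idomainType) (p : A) : Prop :=
  [/\ p != 0, p \isn't a GRing.unit &
      forall a b : A, p = a * b ->
        a \is a GRing.unit \/ b \is a GRing.unit].

(* Equality of products suffices in the uniqueness clause: a unit factor can
   be absorbed into one of the irreducible factors. *)
Definition is_UFD (A : idomainType) : Prop :=
  (forall a : A, a != 0 -> a \isn't a GRing.unit ->
     exists s : seq A,
       (forall p, p \in s -> irreducible_elt p) /\ a = \prod_(p <- s) p)
  /\
  (forall s t : seq A,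
     (forall p, p \in s -> irreducible_elt p) ->
     (forall q, q \in t -> irreducible_elt q) ->
     \prod_(p <- s) p = \prod_(q <- t) q ->
     exists t' : seq A,
       [/\ perm_eq t t', size s = size t' &
           forall i : nat, (i < size s)%N -> associates s`_i t'`_i]).

Definition is_gcd (A : idomainType) (a b g : A) : Prop :=
  [/\ rdivides g a, rdivides g b &
      forall d : A, rdivides d a -> rdivides d b -> rdivides d g].

(* gcd(a, b) = gcd(c, d) up to units; the existence of both gcds is part of
   the assertion, so it is never vacuous. *)
Definition eq_gcd (A : idomainType) (a b c d : A) : Prop :=
  exists g h : A, [/\ is_gcd a b g, is_gcd c d h & associates g h].

(* Main.v *)
Require Import Defs.
From HB Require Import structures.
From mathcomp Require Import all_boot all_order all_algebra.
From mathcomp Require Import ring.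
From Stdlib Require Import Classical.

Set Implicit Arguments.
Unset Strict Implicit.
Unset Printing Implicit Defensive.

Import GRing.Theory.
Local Open Scope ring_scope.

(** The two pairs generate the same ideal, hence have the same common divisors
    and the same gcds.  Write a = alpha / delta, b = beta / delta and
    y = x ^ delta, and work modulo a common divisor d of either pair.  If
    y ^ a = -1 and u y ^ b = -1, raising the second relation to the power a
    gives u ^ a = (-1) ^ (a + b), while a Bezout relation m a = n b + 1 lets one
    solve for y, namely y = (-1) ^ (m + n) u ^ n
    ([congr_solve], [congr_solve_unit]).  Conversely, these values of y and
    u ^ a give back y ^ a = -1 and u y ^ b = -1
    ([congr_power_a], [congr_power_b]).  So rho = n and
    eps = - (-1) ^ (m + n).  The Bezout relation needs a > 0; if alpha = 0 then
    delta = beta, and both pairs are visibly equivalent to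
    (2, x ^ beta + u ^ (-1)).

    Unique factorization only serves to ensure that gcds exist ([UFD_gcd]):
    irreducible elements are prime ([irreducible_prime]), and the gcd of a and b
    is obtained by stripping the irreducible factors of a one at a time. *)

(** * Divisibility and congruences in an integral domain *)

Section Divisibility.
Variable A : idomainType.
Implicit Types a b c d e p x y u : A.

Lemma rdivides_mull a b c : rdivides a b -> rdivides a (c * b).
Proof. by move=> [k ->]; exists (c * k); rewrite mulrA. Qed.

Lemma rdivides_mulr a b c : rdivides a b -> rdivides a (b * c).
Proof. by rewrite mulrC; apply: rdivides_mull. Qed.

Lemma rdividesD d a b : rdivides d a -> rdivides d b -> rdivides d (a + b).
Proof. by move=> [k ->] [l ->]; exists (k + l); rewrite mulrDl. Qed.

Lemma rdividesN d a : rdivides d a -> rdivides d (- a).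
Proof. by move=> [k ->]; exists (- k); rewrite mulNr. Qed.

Lemma rdividesxx a : rdivides a a.
Proof. by exists 1; rewrite mul1r. Qed.

Lemma rdivides0 a : rdivides a 0.
Proof. by exists 0; rewrite mul0r. Qed.

Lemma rdivides_trans b a c : rdivides a b -> rdivides b c -> rdivides a c.
Proof. by move=> dab [k ->]; apply: rdivides_mull. Qed.

Lemma rdivides_unitMl v a b :
  v \is a GRing.unit -> rdivides a (v * b) -> rdivides a b.
Proof. by move=> uv /(rdivides_mull v^-1); rewrite mulKr. Qed.

Lemma rdivides_prod p (s : seq A) : p \in s -> rdivides p (\prod_(q <- s) q).
Proof. by move=> ps; rewrite (big_rem p) //=; apply/rdivides_mulr/rdividesxx. Qed.

Definition congr_mod d a b := rdivides d (a - b).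

Lemma congr_refl d a : congr_mod d a a.
Proof. by rewrite /congr_mod subrr; apply: rdivides0. Qed.

Lemma congr_sym d a b : congr_mod d a b -> congr_mod d b a.
Proof. by move=> /rdividesN; rewrite opprB. Qed.

Lemma congr_trans d b a c : congr_mod d a b -> congr_mod d b c -> congr_mod d a c.
Proof. by move=> /rdividesD h /h; rewrite addrA subrK. Qed.

Lemma congrM d a b a' b' :
  congr_mod d a a' -> congr_mod d b b' -> congr_mod d (a * b) (a' * b').
Proof.
move=> ha hb; rewrite /congr_mod.
have -> : a * b - a' * b' = a * (b - b') + (a - a') * b' by ring.
by apply: rdividesD; [apply: rdivides_mull | apply: rdivides_mulr].
Qed.

Lemma congrMl d c a b : congr_mod d a b -> congr_mod d (c * a) (c * b).
Proof. exact/congrM/congr_refl. Qed.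

Lemma congrX d a b n : congr_mod d a b -> congr_mod d (a ^+ n) (b ^+ n).
Proof.
move=> hab; elim: n => [|n IHn]; first exact: congr_refl.
by rewrite !exprS; apply: congrM.
Qed.

Lemma sign_odd_eq i j : odd i = odd j -> (-1) ^+ i = (-1) ^+ j :> A.
Proof. by move=> e; rewrite -signr_odd e signr_odd. Qed.

(** * Solving y ^ a = -1, u y ^ b = -1 *)

(** Multiplying y ^ (m a) = y ^ (n b) y by u ^ n turns it into
    (-1) ^ m u ^ n = (-1) ^ n y, so that u is never inverted. *)
Lemma congr_solve d y u (a b m n : nat) : (m * a = n * b + 1)%N ->
  congr_mod d (y ^+ a) (-1) -> congr_mod d (u * y ^+ b) (-1) ->
  congr_mod d y ((-1) ^+ (m + n) * u ^+ n).
Proof.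
move=> bez ha hb.
have hm : congr_mod d ((y ^+ a) ^+ m * u ^+ n) ((-1) ^+ m * u ^+ n).
  by apply: congrM; [apply: congrX | apply: congr_refl].
have hn : congr_mod d ((u * y ^+ b) ^+ n * y) ((-1) ^+ n * y).
  by apply: congrM; [apply: congrX | apply: congr_refl].
have eqmn : (y ^+ a) ^+ m * u ^+ n = (u * y ^+ b) ^+ n * y.
  by rewrite -exprM mulnC bez exprMn -exprM mulnC exprD expr1; ring.
rewrite eqmn in hm.
have /(congrMl ((-1) ^+ n)) := congr_trans (congr_sym hn) hm.
by rewrite signrMK mulrA -exprD addnC.
Qed.

Lemma congr_solve_unit d y u (a b : nat) :
  congr_mod d (y ^+ a) (-1) -> congr_mod d (u * y ^+ b) (-1) ->
  congr_mod d (u ^+ a) ((-1) ^+ (a + b)).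
Proof.
move=> /(congrX b) ha /(congrX a) hb.
have /(congrMl ((-1) ^+ b)) : congr_mod d (u ^+ a * (-1) ^+ b) ((-1) ^+ a).
  apply: congr_trans hb; rewrite exprMn -exprM mulnC exprM.
  exact/congrMl/congr_sym.
by rewrite mulrCA -expr2 sqrr_sign mulr1 -exprD addnC.
Qed.

Lemma congr_power_a d y u (a b m n : nat) : (m * a = n * b + 1)%N ->
  congr_mod d y ((-1) ^+ (m + n) * u ^+ n) ->
  congr_mod d (u ^+ a) ((-1) ^+ (a + b)) ->
  congr_mod d (y ^+ a) (-1).
Proof.
move=> /(congr1 odd) bez /(congrX a) hy /(congrX n) hu.
apply: congr_trans hy _; rewrite exprMn -exprM -[(u ^+ n) ^+ a]exprM.
rewrite (mulnC n a) [u ^+ _]exprM; apply: congr_trans (congrMl _ hu) _.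
rewrite -exprM -exprD -[X in congr_mod _ _ X]expr1.
rewrite (@sign_odd_eq _ 1); first exact: congr_refl.
move: bez; rewrite !(oddD, oddM).
by case: (odd m); case: (odd n); case: (odd a); case: (odd b).
Qed.

Lemma congr_power_b d y u (a b m n : nat) : (m * a = n * b + 1)%N ->
  congr_mod d y ((-1) ^+ (m + n) * u ^+ n) ->
  congr_mod d (u ^+ a) ((-1) ^+ (a + b)) ->
  congr_mod d (u * y ^+ b) (-1).
Proof.
move=> bez /(congrX b) hy /(congrX m) hu.
apply: congr_trans (congrMl u hy) _.
(* u (u ^ n) ^ b = u ^ (n b + 1) = (u ^ a) ^ m *)
rewrite exprMn -exprM -[(u ^+ n) ^+ b]exprM mulrCA -exprS -addn1 -bez.
rewrite (mulnC m a) [u ^+ _]exprM; apply: congr_trans (congrMl _ hu) _.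
rewrite -exprM -exprD -[X in congr_mod _ _ X]expr1.
rewrite (@sign_odd_eq _ 1); first exact: congr_refl.
move: bez => /(congr1 odd); rewrite !(oddD, oddM).
by case: (odd m); case: (odd n); case: (odd a); case: (odd b).
Qed.

(** * Existence of gcds in a unique factorization domain *)

Definition prime_elt p :=
  p != 0 /\ forall a b, rdivides p (a * b) -> rdivides p a \/ rdivides p b.

Lemma irreducible_unitMl v p :
  v \is a GRing.unit -> irreducible_elt p -> irreducible_elt (v * p).
Proof.
move=> uv [p0 pNu pirr]; split.
- by rewrite mulf_neq0 //; apply: contraTneq uv => ->; rewrite unitr0.
- by rewrite unitrMr.
move=> a b e; have /pirr : p = (v^-1 * a) * b by rewrite -mulrA -e mulKr.
by rewrite unitrMr ?unitrV.
Qed.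

Lemma UFD_factorization (hA : is_UFD A) a : a != 0 ->
  exists v (s : seq A), [/\ v \is a GRing.unit,
    forall p, p \in s -> irreducible_elt p & a = v * \prod_(p <- s) p].
Proof.
move=> a0; have [ua|nua] := boolP (a \is a GRing.unit).
  by exists a, [::]; rewrite big_nil mulr1; split.
have [s [irr_s ->]] := hA.1 a a0 nua.
by exists 1, s; rewrite unitr1 mul1r; split.
Qed.

(** If the cofactor of p in the product is v r_1 ... r_k, with v a unit and the
    r_i irreducible, then v p, r_1, ..., r_k is another factorization of the
    product, so v p is associate to one of the given factors. *)
Lemma irreducible_dvd_prod (hA : is_UFD A) p (s : seq A) :
  irreducible_elt p -> (forall q, q \in s -> irreducible_elt q) ->
  rdivides p (\prod_(q <- s) q) -> exists2 q, q \in s & rdivides p q.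
Proof.
move=> irr_p irr_s [c ec].
have c0 : c != 0.
  have : \prod_(q <- s) q != 0.
    by rewrite prodf_seq_neq0; apply/allP => q /irr_s [].
  by rewrite ec mulf_eq0 negb_or => /andP[].
have [v [r [uv irr_r cE]]] := UFD_factorization hA c0.
have irr_vpr q : q \in v * p :: r -> irreducible_elt q.
  by rewrite inE => /predU1P[->|/irr_r //]; apply: irreducible_unitMl.
have [|s' [perm_s' sz assoc]] := hA.2 _ _ irr_vpr irr_s.
  by rewrite big_cons ec cE; ring.
have [w _ /= s'E] := assoc 0%N isT.
exists s'`_0; last by rewrite s'E; exists (w * v); rewrite mulrA.
by rewrite (perm_mem perm_s') mem_nth // -sz.
Qed.

Lemma irreducible_prime (hA : is_UFD A) p : irreducible_elt p -> prime_elt p.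
Proof.
move=> irr_p; split=> [|a b pab]; first by case: irr_p.
have [->|a0] := eqVneq a 0; first by left; apply: rdivides0.
have [->|b0] := eqVneq b 0; first by right; apply: rdivides0.
have [v [s [uv irr_s aE]]] := UFD_factorization hA a0.
have [w [t [uw irr_t bE]]] := UFD_factorization hA b0.
have [] := @irreducible_dvd_prod hA p (s ++ t) irr_p.
- by move=> q; rewrite mem_cat => /orP[/irr_s | /irr_t].
- apply: (@rdivides_unitMl (v * w)); first by rewrite unitrMr.
  by rewrite big_cat /= mulrACA -aE -bE.
move=> q; rewrite mem_cat => /orP[qs | qt] pq.
  by left; rewrite aE; apply/rdivides_mull/(rdivides_trans pq)/rdivides_prod.
by right; rewrite bE; apply/rdivides_mull/(rdivides_trans pq)/rdivides_prod.
Qed.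

Lemma rdivides_prime_cancel p d a : prime_elt p -> ~ rdivides p d ->
  rdivides d (p * a) -> rdivides d a.
Proof.
move=> [p0 pP] npd [c ec].
have [|[k ck]|/npd []] := pP c d; first by rewrite -ec; apply/rdivides_mulr/rdividesxx.
by exists k; apply: (mulfI p0); rewrite ec ck; ring.
Qed.

(** The rule gcd(pa, pb) = p gcd(a, b), which can fail in a general
    domain when gcd(pa, pb) is not known to exist, holds for prime p: a common
    divisor prime to p divides a and b, and the others may be divided by p. *)
Lemma is_gcd_primeM p a b g : prime_elt p ->
  is_gcd a b g -> is_gcd (p * a) (p * b) (p * g).
Proof.
move=> prime_p [ga gb gmax]; have [p0 _] := prime_p.
split; first by have [k ->] := ga; exists k; ring.
  by have [k ->] := gb; exists k; ring.
move=> d da db; have [[d' dE]|npd] := classic (rdivides p d).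
  have div_d' c : rdivides d (p * c) -> rdivides d' c.
    by move=> [k ek]; exists k; apply: (mulfI p0); rewrite ek dE; ring.
  have [k ->] := gmax d' (div_d' a da) (div_d' b db).
  by exists k; rewrite dE; ring.
by apply/rdivides_mull/gmax; apply: (rdivides_prime_cancel prime_p).
Qed.

Lemma is_gcd_prime_coprime p a b g : prime_elt p -> ~ rdivides p b ->
  is_gcd a b g -> is_gcd (p * a) b g.
Proof.
move=> prime_p npb [ga gb gmax]; split=> //; first exact: rdivides_mull.
move=> d da db; apply: gmax => //; apply: (rdivides_prime_cancel prime_p) => //.
by move=> pd; apply/npb/(rdivides_trans pd).
Qed.

Lemma is_gcd_prod_primes (s : seq A) v b : v \is a GRing.unit ->
  (forall p, p \in s -> prime_elt p) ->
  exists g, is_gcd (v * \prod_(p <- s) p) b g.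
Proof.
move=> uv; elim: s b => [|p s IHs] b prime_s.
  exists 1; split=> [||d]; first by exists (v * \prod_(p <- [::]) p); rewrite mulr1.
    by exists b; rewrite mulr1.
  by move=> + _; rewrite big_nil; apply: rdivides_unitMl.
have prime_p : prime_elt p by apply: prime_s; rewrite mem_head.
have {}IHs c : exists g, is_gcd (v * \prod_(q <- s) q) c g.
  by apply: IHs => q qs; apply: prime_s; rewrite inE qs orbT.
rewrite big_cons mulrCA.
have [[c ->]|npb] := classic (rdivides p b).
  have [g gP] := IHs c.
  by exists (p * g); rewrite (mulrC c); apply: is_gcd_primeM.
by have [g gP] := IHs b; exists g; apply: is_gcd_prime_coprime.
Qed.

Lemma UFD_gcd (hA : is_UFD A) a b : exists g, is_gcd a b g.
Proof.
have [->|a0] := eqVneq a 0.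
  by exists b; split=> //; [apply: rdivides0 | apply: rdividesxx].
have [v [s [uv irr_s ->]]] := UFD_factorization hA a0.
by apply: is_gcd_prod_primes => // p /irr_s; apply: irreducible_prime.
Qed.

Lemma eq_gcd_of_common_divisors (hA : is_UFD A) a b a' b' :
  (forall d, rdivides d a /\ rdivides d b <-> rdivides d a' /\ rdivides d b') ->
  eq_gcd a b a' b'.
Proof.
move=> E; have [g gP] := UFD_gcd hA a b; have [ga gb gmax] := gP.
have [ga' gb'] := (E g).1 (conj ga gb).
exists g, g; split=> //; last by exists 1; rewrite ?unitr1 ?mul1r.
by split=> // d da' db'; have [] := (E d).2 (conj da' db'); apply: gmax.
Qed.

(** * The exponents *)

Lemma signz_sub (a b : nat) : (-1) ^ (a%:Z - b%:Z) = (-1) ^+ (a + b) :> A.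
Proof. by rewrite exprzDr ?unitrN1 // -exprz_inv invrN1 exprD. Qed.

Lemma signz_div_sub (a b delta : nat) : (0 < delta)%N ->
  (-1) ^ (((a * delta)%N%:Z - (b * delta)%N%:Z)%R %/ delta%:Z)%Z
    = (-1) ^+ (a + b) :> A.
Proof.
by move=> delta0; rewrite !PoszM -mulrBl mulzK ?signz_sub // eqz_nat -lt0n.
Qed.

End Divisibility.

Theorem proposition3p1 (A : idomainType) (hA : is_UFD A) (x u : A)
    (hu : u \is a GRing.unit) (alpha beta : nat)
    (hab : ~ (alpha = 0%N /\ beta = 0%N)) :
  let delta := gcdn alpha beta in
  exists (rho : int) (eps : A),
    (eps = 1 \/ eps = -1) /\
    eq_gcd (x ^+ alpha + 1) (u * x ^+ beta + 1)
           (x ^+ delta + eps * u ^ rho)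
           (u ^+ (alpha %/ delta)%N
              - (-1) ^ ((alpha%:Z - beta%:Z)%R %/ delta%:Z)%Z).
Proof.
move=> delta.
have delta_gt0 : (0 < delta)%N.
  rewrite gcdn_gt0 !lt0n; apply/orP.
  by case: eqP => [a0|_]; [right; apply/eqP => b0; apply: hab | left].
have [a alphaE] := dvdnP (dvdn_gcdl alpha beta : delta %| alpha)%N.
have [b betaE] := dvdnP (dvdn_gcdr alpha beta : delta %| beta)%N.
rewrite [X in (X %/ delta)%N]alphaE mulnK // [X in X%:Z - _]alphaE.
rewrite [X in _ - X%:Z]betaE signz_div_sub //.
have [a0|a_gt0] := posnP a.
  have alpha0 : alpha = 0%N by rewrite alphaE a0.
  have betad : beta = delta by rewrite /delta alpha0 gcd0n.
  have b1 : b = 1%N.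
    by apply/eqP; rewrite -(eqn_pmul2r delta_gt0) -betaE betad mul1n.
  exists (-1), 1; split; first by left.
  apply: eq_gcd_of_common_divisors => // d.
  rewrite alpha0 betad a0 b1 mul1r !expr0 add0n expr1 opprK -[u ^ (-1)]/(u^-1).
  have -> : u * x ^+ delta + 1 = u * (x ^+ delta + u^-1).
    by rewrite mulrDr mulrV.
  by split=> -[h1 h2]; split=> //; [apply: rdivides_unitMl h2 | apply: rdivides_mull].
have [m n mnE _] := egcdnP b a_gt0.
have {}mnE : (m * a = n * b + 1)%N.
  suff ab1 : gcdn a b = 1%N by rewrite mnE ab1.
  apply/eqP; rewrite -(eqn_pmul2r delta_gt0) muln_gcdl -alphaE -betaE mul1n.
  exact: eqxx.
exists n%:Z, (- (-1) ^+ (m + n)); split.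
  by rewrite -signr_odd; case: (odd _); [left; rewrite opprK | right].
apply: eq_gcd_of_common_divisors => // d.
rewrite mulNr alphaE (mulnC a) exprM betaE (mulnC b) exprM.
(* x + 1 = x - (- 1): the four divisibilities become congruences *)
rewrite -{1 2}[1]opprK.
split=> -[h1 h2]; split.
- exact: congr_solve mnE h1 h2.
- exact: congr_solve_unit h1 h2.
- exact: congr_power_a mnE h1 h2.
exact: congr_power_b mnE h1 h2.
Qed.
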